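(* Let $(M^{2n+1},\phi,\xi,\eta,g)$ be a contact metric manifold which is a generalized $(\kappa,\mu)$-space form $M(f_1,\ldots,f_6)$. Then $M$ is a generalized $(\kappa,\mu)$-space with $\kappa=f_1-f_3$ and $\mu=f_4-f_6$; that is, for all vector fields $X,Y$ on $M$, $$R(X,Y)\xi=(f_1-f_3)\{\eta(Y)X-\eta(X)Y\}+(f_4-f_6)\{\eta(Y)hX-\eta(X)hY\}.$$
   Context: All functions and tensors are smooth; $n\ge 1$. An almost contact metric manifold $(M^{2n+1},\phi,\xi,\eta,g)$ is a Riemannian manifold $(M,g)$ with a $(1,1)$-tensor field $\phi$, a vector field $\xi$ and a 1-form $\eta$ with $\eta(\xi)=1$, $\phi^2X=-X+\eta(X)\xi$, $g(\phi X,\phi Y)=g(X,Y)-\eta(X)\eta(Y)$. It is a contact metric manifold if $d\eta(X,Y)=g(X,\phi Y)$, with the convention $2\,d\eta(X,Y)=X\eta(Y)-Y\eta(X)-\eta([X,Y])$. Put $h=\tfrac12 L_\xi\phi$ ($L$ the Lie derivative). The curvature is $R(X,Y)Z=\nabla_X\nabla_YZ-\nabla_Y\nabla_XZ-\nabla_{[X,Y]}Z$, $\nabla$ the Levi-Civita connection. An almost contact metric manifold is a generalized $(\kappa,\mu)$-space form, denoted $M(f_1,\ldots,f_6)$, if there are functions $f_1,\ldots,f_6$ on $M$ with $R=\sum_{i=1}^6 f_iR_i$, where $R_1(X,Y)Z=g(Y,Z)X-g(X,Z)Y$; $R_2(X,Y)Z=g(X,\phi Z)\phi Y-g(Y,\phi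 Z)\phi X+2g(X,\phi Y)\phi Z$; $R_3(X,Y)Z=\eta(X)\eta(Z)Y-\eta(Y)\eta(Z)X+g(X,Z)\eta(Y)\xi-g(Y,Z)\eta(X)\xi$; $R_4(X,Y)Z=g(Y,Z)hX-g(X,Z)hY+g(hY,Z)X-g(hX,Z)Y$; $R_5(X,Y)Z=g(hY,Z)hX-g(hX,Z)hY+g(\phi hX,Z)\phi hY-g(\phi hY,Z)\phi hX$; $R_6(X,Y)Z=\eta(X)\eta(Z)hY-\eta(Y)\eta(Z)hX+g(hX,Z)\eta(Y)\xi-g(hY,Z)\eta(X)\xi$. A contact metric manifold is a generalized $(\kappa,\mu)$-space if there are functions $\kappa,\mu$ on $M$ with $R(X,Y)\xi=\kappa\{\eta(Y)X-\eta(X)Y\}+\mu\{\eta(Y)hX-\eta(X)hY\}$ for all $X,Y$. *)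

(* Defs.v *)
From HB Require Import structures.
From mathcomp Require Import all_boot all_order all_algebra.
From mathcomp Require Import all_classical all_reals all_analysis.

Set Implicit Arguments.
Unset Strict Implicit.
Unset Printing Implicit Defensive.

Import Order.TTheory GRing.Theory Num.Theory.
Import numFieldNormedType.Exports.

Local Open Scope classical_set_scope.
Local Open Scope ring_scope.

Section SmoothOn.
Context {R : realType} {m : nat}.
Implicit Types (U : set 'rV[R]_m) (f g : 'rV[R]_m -> R).

(* C^k functions on the open set U: the iterated partial derivatives of order
   at most k exist and are continuous at every point of U.  As U is open, the
   values of the total function f outside U are irrelevant (Ck_eq below). *)
Fixpoint Ck (k : nat) U f : Prop :=
  (forall x, U x -> {for x, continuous f}) /\
  if k is k'.+1 then forall i : 'I_m,
    (forall x, U x -> derivable f x (delta_mx 0 i)) /\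
    Ck k' U (derive f ^~ (delta_mx 0 i))
  else True.

Definition smooth_on U f := forall k, Ck k U f.

Lemma Ck_eq k U f g : open U -> (forall x, U x -> f x = g x) ->
  Ck k U f -> Ck k U g.
Proof.
move=> oU; have near_eq f' g' : (forall x, U x -> f' x = g' x) ->
    forall x, U x -> \forall y \near x, f' y = g' y.
  move=> fg x Ux; apply: (@filterS _ _ _ U); first exact: fg.
  exact: open_nbhs_nbhs.
have cont_eq f' g' : (forall x, U x -> f' x = g' x) ->
    (forall x, U x -> {for x, continuous f'}) ->
    forall x, U x -> {for x, continuous g'}.
  move=> fg cf x Ux; rewrite /prop_for /continuous_at -(fg _ Ux).
  by apply: cvg_trans (cf _ Ux); apply: (@near_eq_cvg _ _ (nbhs x)); exact: near_eq.
elim: k f g => [|k IH] f g fg /= [cf df]; split=> //; try exact: cont_eq cf.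
move=> i; have [di Di] := df i; split=> [x Ux|].
  by apply: near_eq_derivable (di _ Ux); exact: near_eq.
by apply: IH Di => x Ux; apply: near_eq_derive; exact: near_eq.
Qed.

Lemma CkS k U f : Ck k.+1 U f -> Ck k U f.
Proof.
elim: k f => [|k IH] f [cf df]; first by split.
by split=> // i; have [di Di] := df i; split=> //; exact: IH.
Qed.

Lemma Ck_cst k U c : open U -> Ck k U (cst c).
Proof.
move=> oU; elim: k c => [|k IH] c; (split; first by move=> x _; exact: cst_continuous) => //.
move=> i; split=> [x _|]; first exact: derivable_cst.
by apply: Ck_eq (IH 0) => // x _; rewrite derive_cst.
Qed.

Lemma CkD k U f g : open U -> Ck k U f -> Ck k U g -> Ck k U (f + g).
Proof.
move=> oU; elim: k f g => [|k IH] f g /= [cf df] [cg dg].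
  by split=> // x Ux; exact: (continuousD (cf _ Ux) (cg _ Ux)).
split=> [x Ux|i]; first by exact: (continuousD (cf _ Ux) (cg _ Ux)).
have [di Di] := df i; have [ei Ei] := dg i; split=> [x Ux|].
  by apply: derivableD; [exact: di|exact: ei].
by apply: Ck_eq (IH _ _ Di Ei) => // x Ux; rewrite deriveD//; [exact: di|exact: ei].
Qed.

Lemma CkM k U f g : open U -> Ck k U f -> Ck k U g -> Ck k U (f * g).
Proof.
move=> oU; elim: k f g => [|k IH] f g Cf Cg.
  case: Cf Cg => [cf _] [cg _].
  by split=> // x Ux; exact: (continuousM (cf _ Ux) (cg _ Ux)).
have Cf' := CkS Cf; have Cg' := CkS Cg; case: Cf Cg => [cf df] [cg dg].
split=> [x Ux|i]; first by exact: (continuousM (cf _ Ux) (cg _ Ux)).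
have [di Di] := df i; have [ei Ei] := dg i; split=> [x Ux|].
  by apply: derivableM; [exact: di|exact: ei].
apply: Ck_eq (CkD oU (IH _ _ Cf' Ei) (IH _ _ Cg' Di)) => // x Ux.
by rewrite deriveM//; [exact: di|exact: ei].
Qed.

End SmoothOn.

(* A chart: a homeomorphism from an open subset of M onto an open subset of
   R^m; chart_map and chart_inv are arbitrary outside these subsets. *)
Record chart (R : realType) (m : nat) (M : topologicalType) := Chart {
  chart_dom : set M;
  chart_map : M -> 'rV[R]_m;
  chart_inv : 'rV[R]_m -> M;
  chart_dom_open : open chart_dom;
  chart_cod_open : open (chart_map @` chart_dom);
  chart_mapK : forall p, chart_dom p -> chart_inv (chart_map p) = p;
  chart_map_cont : {within chart_dom, continuous chart_map};
  chart_inv_cont : {within chart_map @` chart_dom, continuous chart_inv} }.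

Record smoothManifold (R : realType) (m : nat) := SmoothManifold {
  manifold_sort :> topologicalType;
  manifold_hausdorff : hausdorff_space manifold_sort;
  manifold_second_countable : @second_countable manifold_sort;
  atlas : set (chart R m manifold_sort);
  atlas_cover : forall p, exists2 c, atlas c & chart_dom c p;
  atlas_compatible : forall c d, atlas c -> atlas d -> forall j : 'I_m,
    smooth_on (chart_map c @` (chart_dom c `&` chart_dom d))
      (fun x => chart_map d (chart_inv c x) 0 j) }.

Section SmoothFunctions.
Context {R : realType} {m : nat} (M : smoothManifold R m).

(* It suffices to test smoothness on one atlas, not on the maximal one. *)
Definition smooth (f : M -> R) := forall c, atlas c ->
  smooth_on (chart_map c @` chart_dom c) (fun x => f (chart_inv c x)).

Definition smooth_pred : pred (M -> R) := fun f => `[< smooth f >].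

Lemma smooth_subring_closed : subring_closed smooth_pred.
Proof.
have cstP (c : R) : smooth (cst c).
  by move=> d dA k; apply: Ck_cst; exact: chart_cod_open.
have MP f g : smooth f -> smooth g -> smooth (f * g).
  move=> sf sg d dA k.
  by apply: CkM; [exact: chart_cod_open|exact: sf|exact: sg].
split=> [|f g /asboolP sf /asboolP sg|f g /asboolP sf /asboolP sg].
- by apply/asboolP; exact: cstP.
- apply/asboolP => d dA k.
  have -> : (fun x => (f - g) (chart_inv d x)) =
      (fun x => f (chart_inv d x)) + (fun x => (cst (- 1) * g) (chart_inv d x)).
    by apply/funext => x; rewrite !fctE mulN1r.
  apply: CkD; [exact: chart_cod_open|exact: sf|].
  exact: (MP _ _ (cstP (- 1)) sg).
- by apply/asboolP; exact: MP.
Qed.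

HB.instance Definition _ :=
  GRing.isSubringClosed.Build _ smooth_pred smooth_subring_closed.

(* The ring C^oo(M). *)
Record cinf := Cinf { cinf_fun :> M -> R ; _ : cinf_fun \in smooth_pred }.

HB.instance Definition _ := [isSub for cinf_fun].
HB.instance Definition _ := [Choice of cinf by <:].
HB.instance Definition _ := GRing.SubChoice_isSubComPzRing.Build _ _ cinf smooth_subring_closed.

Lemma smooth_cst (c : R) : cst c \in smooth_pred.
Proof.
by apply/asboolP => d dA k; apply: Ck_cst; exact: chart_cod_open.
Qed.

Definition cst_cinf (c : R) : cinf := Cinf (smooth_cst c).

(* Vector fields are taken as the R-linear derivations of C^oo(M); M being
   Hausdorff and second countable, these are the smooth sections of TM. *)
Definition derivation (D : cinf -> cinf) :=
  (forall (c : R) f g, D (cst_cinf c * f + g) = cst_cinf c * D f + D g) /\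
  (forall f g, D (f * g) = f * D g + g * D f).

Definition derivation_pred : pred (cinf -> cinf^o) :=
  fun D => `[< derivation D >].

Lemma derivation_submod_closed : submod_closed derivation_pred.
Proof.
split=> [|a D E /asboolP[lD mD] /asboolP[lE mE]]; apply/asboolP.
  split=> [c f g|f g].
    by rewrite -[LHS]/(0 : cinf) -[RHS]/(cst_cinf c * 0 + 0 : cinf) mulr0 addr0.
  by rewrite -[LHS]/(0 : cinf) -[RHS]/(f * 0 + g * 0 : cinf) !mulr0 addr0.
have DE f : (a *: D + E) f = a * D f + E f by [].
split=> [c f g|f g]; rewrite !DE.
  by rewrite lD lE !mulrDr [a * (_ * _)]mulrCA addrACA.
by rewrite mD mE !mulrDr [a * (f * _)]mulrCA [a * (g * _)]mulrCA addrACA.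
Qed.

HB.instance Definition _ := GRing.isSubmodClosed.Build cinf (cinf -> cinf^o)
  derivation_pred derivation_submod_closed.

(* The C^oo(M)-module of vector fields.  A tensor field is accordingly a
   C^oo(M)-multilinear map on vector fields. *)
Record vfield := VField {
  vfield_fun :> cinf -> cinf^o ; _ : vfield_fun \in derivation_pred }.

HB.instance Definition _ := [isSub for vfield_fun].
HB.instance Definition _ := [Choice of vfield by <:].
HB.instance Definition _ := [SubChoice_isSubLmodule of vfield by <:].

Lemma vfieldP (X : vfield) : derivation X.
Proof. by case: X => X /= /asboolP. Qed.

Lemma bracket_subproof (X Y : vfield) :
  (fun f => X (Y f) - Y (X f)) \in derivation_pred.
Proof.
have [[lX mX] [lY mY]] := (vfieldP X, vfieldP Y).
have XD f g : X (f + g) = X f + X g.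
  have := lX 1 f g; have -> : cst_cinf 1 = 1 by exact: val_inj.
  by rewrite !mul1r.
have YD f g : Y (f + g) = Y f + Y g.
  have := lY 1 f g; have -> : cst_cinf 1 = 1 by exact: val_inj.
  by rewrite !mul1r.
apply/asboolP; split=> [c f g|f g].
  by rewrite lY lX lX lY mulrBr opprD addrACA.
rewrite mY mX XD YD !mX !mY !mulrBr [X f * _]mulrC [X g * _]mulrC.
have cancel (a b c d a' b' : cinf) :
    a + b + (c + d) + (- a' - d + (- b' - c)) = a - a' + (b - b').
  rewrite [- a' - d + _]addrACA [LHS]addrACA.
  by rewrite [- d + _]addrC -[- c - d]opprD subrr addr0 [LHS]addrACA.
by rewrite addrACA !opprD cancel.
Qed.

Definition bracket (X Y : vfield) : vfield := VField (bracket_subproof X Y).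

(* (L_X T) Y for a tensor field T of type (1,1) *)
Definition lie_derivative (X : vfield) (T : vfield -> vfield) (Y : vfield) :
  vfield := bracket X (T Y) - T (bracket X Y).

(* The convention with the factor 1/2. *)
Definition dext (eta : vfield -> cinf) (X Y : vfield) : cinf :=
  cst_cinf 2^-1 * (X (eta Y) - Y (eta X) - eta (bracket X Y)).

(* The value of X at p is nonzero iff X f p <> 0 for some f, so riem_pos says
   that the form induced on each tangent space is positive definite. *)
Record riemannian_metric := RiemannianMetric {
  riem_form :> vfield -> vfield -> cinf;
  riem_sym : forall X Y, riem_form X Y = riem_form Y X;
  riem_linear : forall Y, scalar (fun X => riem_form X Y);
  riem_pos : forall (X : vfield) (p : M),
    (exists f : cinf, X f p != 0) -> 0 < riem_form X X p }.

Record affine_connection := AffineConnection {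
  nabla :> vfield -> vfield -> vfield;
  nabla_linear : forall Y, linear (fun X => nabla X Y);
  nablaD : forall X Y Z, nabla X (Y + Z) = nabla X Y + nabla X Z;
  nabla_leibniz : forall X (f : cinf) Y,
    nabla X (f *: Y) = (X f : cinf) *: Y + f *: nabla X Y }.

Definition levi_civita (g : riemannian_metric) (D : affine_connection) :=
  (forall X Y, D X Y - D Y X = bracket X Y) /\
  (forall X Y Z : vfield, X (g Y Z) = g (D X Y) Z + g Y (D X Z)).

Definition curvature (D : affine_connection) (X Y Z : vfield) : vfield :=
  D X (D Y Z) - D Y (D X Z) - D (bracket X Y) Z.

Section AlmostContact.
Variables (phi : {linear vfield -> vfield}) (xi : vfield).
Variables (eta : {scalar vfield}) (g : riemannian_metric).

Definition almost_contact_metric :=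
  [/\ eta xi = 1,
      forall X, phi (phi X) = - X + eta X *: xi
    & forall X Y, g (phi X) (phi Y) = g X Y - eta X * eta Y].

Definition contact_metric :=
  almost_contact_metric /\ forall X Y, dext eta X Y = g X (phi Y).

Definition tensor_h (X : vfield) : vfield :=
  cst_cinf 2^-1 *: lie_derivative xi phi X.

Local Notation h := tensor_h.

Definition R1 (X Y Z : vfield) : vfield := g Y Z *: X - g X Z *: Y.

Definition R2 (X Y Z : vfield) : vfield :=
  g X (phi Z) *: phi Y - g Y (phi Z) *: phi X + (g X (phi Y) *+ 2) *: phi Z.

Definition R3 (X Y Z : vfield) : vfield :=
  (eta X * eta Z) *: Y - (eta Y * eta Z) *: X
  + (g X Z * eta Y) *: xi - (g Y Z * eta X) *: xi.

Definition R4 (X Y Z : vfield) : vfield :=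
  g Y Z *: h X - g X Z *: h Y + g (h Y) Z *: X - g (h X) Z *: Y.

Definition R5 (X Y Z : vfield) : vfield :=
  g (h Y) Z *: h X - g (h X) Z *: h Y
  + g (phi (h X)) Z *: phi (h Y) - g (phi (h Y)) Z *: phi (h X).

Definition R6 (X Y Z : vfield) : vfield :=
  (eta X * eta Z) *: h Y - (eta Y * eta Z) *: h X
  + (g (h X) Z * eta Y) *: xi - (g (h Y) Z * eta X) *: xi.

Variable D : affine_connection.

(* D is meant to be the Levi-Civita connection of g. *)
Definition generalized_km_space_form (f1 f2 f3 f4 f5 f6 : cinf) :=
  almost_contact_metric /\
  forall X Y Z, curvature D X Y Z =
    f1 *: R1 X Y Z + f2 *: R2 X Y Z + f3 *: R3 X Y Z +
    f4 *: R4 X Y Z + f5 *: R5 X Y Z + f6 *: R6 X Y Z.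

Definition generalized_km_space (kappa mu : cinf) :=
  contact_metric /\
  forall X Y, curvature D X Y xi =
    kappa *: (eta Y *: X - eta X *: Y) + mu *: (eta Y *: h X - eta X *: h Y).

End AlmostContact.

End SmoothFunctions.

(* Main.v *)
(* Since [phi^2 xi = 0], computing [phi^3 xi] in two ways gives [phi xi = a xi]
   with [a^2 = 0], so [phi xi = 0], hence [eta X = g X xi] and [eta \o phi = 0].
   Only [h] involves derivatives: the contact condition
   [d eta (xi, phi X) = eta (phi (phi X)) = 0] yields
   [eta [xi, phi X] = 0], hence [eta \o h = 0].  With these identities the
   formula for [R] at [Z = xi] collapses: [R_2] and [R_5] vanish,
   [R_3 = - R_1] and [R_6 = - R_4]. *)
Require Import Defs.
From mathcomp Require Import all_boot all_order all_algebra.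
From mathcomp Require Import all_classical all_reals all_analysis.

Import GRing.Theory.
Local Open Scope ring_scope.

(** [cinf M] has zero divisors but no nilpotents: values at each point lie in the field [R]. *)
Lemma cinf_sqr_eq0 (R : realType) (m : nat) (M : smoothManifold R m)
    (a : cinf M) : a * a = 0 -> a = 0.
Proof.
move=> aa0; apply: val_inj; apply/funext => p /=.
have /eqP := congr1 (fun b : cinf M => b p) aa0.
by rewrite -[X in X == _]/(a p * a p) mulf_eq0 orbb => /eqP.
Qed.

Section VectorFields.
Context {R : realType} {m : nat} {M : smoothManifold R m}.
Implicit Types X : vfield M.

Lemma cst_cinf_half_double (a : cinf M) : cst_cinf M 2^-1 * (a + a) = a.
Proof.
apply: val_inj; apply/funext => p /=.
rewrite -[LHS]/(2^-1 * (a p + a p)) -mulr2n -[a p *+ 2]mulr_natl mulrA.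
by rewrite mulVf ?mul1r // Num.Theory.pnatr_eq0.
Qed.

Lemma vfield0 X : X 0 = 0.
Proof.
have [_ mX] := vfieldP X.
by have := mX 0 0; rewrite !mul0r addr0.
Qed.

Lemma vfield1 X : X 1 = 0.
Proof.
have [_ mX] := vfieldP X.
have /eqP := mX 1 1; rewrite !mul1r -subr_eq0 opprD addrA subrr sub0r oppr_eq0.
by move/eqP.
Qed.

Lemma dext_eq0 (eta : vfield M -> cinf M) (X Y : vfield M) :
  dext eta X Y = 0 -> eta (bracket X Y) = X (eta Y) - Y (eta X).
Proof.
rewrite /dext => d0; apply/esym/eqP; rewrite -subr_eq0.
(* Writing the difference [a] as half of [a + a] turns each summand into [dext eta X Y]. *)
by rewrite -[X in X == _]cst_cinf_half_double mulrDr d0 addr0.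
Qed.

End VectorFields.

Section AlmostContactMetric.
Set Implicit Arguments.
Context {R : realType} {m : nat} {M : smoothManifold R m}.
Variables (phi : {linear vfield M -> vfield M}) (xi : vfield M).
Variables (eta : {scalar vfield M}) (g : riemannian_metric M).
Implicit Types X Y : vfield M.
Hypothesis acm : almost_contact_metric phi xi eta g.

Lemma phi_xi : phi xi = 0.
Proof.
have [eta1 phi2 _] := acm.
have phi2xi : phi (phi xi) = 0 by rewrite phi2 eta1 scale1r addNr.
have [a phixi] : exists a, phi xi = a *: xi.
  (* [phi2] at [phi xi], whose left side is [phi 0], forces this witness. *)
  exists (eta (phi xi)); have := phi2 (phi xi); rewrite phi2xi linear0 => /eqP.
  by rewrite addrC eq_sym subr_eq0 => /eqP.
suff a0 : a = 0 by rewrite phixi a0 scale0r.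
apply: cinf_sqr_eq0; move: phi2xi; rewrite phixi linearZ /= phixi scalerA.
by move/(congr1 eta); rewrite linear0 linearZ /= eta1 mulr1.
Qed.

(** Computing [phi (phi (phi X))] in two ways leaves [eta (phi X) *: xi = 0]. *)
Lemma eta_phi X : eta (phi X) = 0.
Proof.
have [eta1 phi2 _] := acm.
have := congr1 phi (phi2 X).
rewrite phi2 linearD linearN linearZ /= phi_xi scaler0.
move/addrI/(congr1 eta).
by rewrite linear0 linearZ /= eta1 mulr1.
Qed.

Lemma metric0r X : g X 0 = 0.
Proof.
rewrite riem_sym; have := riem_linear g X 1 0 0.
by rewrite scale1r addr0 mul1r -[LHS]addr0 => /addrI.
Qed.

(** Compatibility of [g] with [phi] at the pair [X], [xi], where [phi xi = 0]. *)
Lemma metric_xi X : g X xi = eta X.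
Proof.
have [eta1 _ gphi] := acm.
have /eqP := gphi X xi.
by rewrite phi_xi metric0r eta1 mulr1 eq_sym subr_eq0 => /eqP.
Qed.

Lemma eta_tensor_h X :
  (forall Y, dext eta xi Y = g xi (phi Y)) -> eta (tensor_h phi xi X) = 0.
Proof.
have [eta1 _ _] := acm => deta.
rewrite /tensor_h /lie_derivative linearZ linearB /= eta_phi subr0.
rewrite dext_eq0; last by rewrite deta riem_sym metric_xi eta_phi.
(* Both remaining terms differentiate constants: [eta (phi X) = 0] and [eta xi = 1]. *)
by rewrite eta_phi eta1 vfield0 vfield1 subr0 mulr0.
Qed.

End AlmostContactMetric.

Theorem theorem4p1 (R : realType) (n : nat) (n_ge1 : (1 <= n)%N)
    (M : smoothManifold R (2 * n + 1))
    (phi : {linear vfield M -> vfield M}) (xi : vfield M)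
    (eta : {scalar vfield M}) (g : riemannian_metric M)
    (D : affine_connection M) (f1 f2 f3 f4 f5 f6 : cinf M) :
  levi_civita g D ->
  contact_metric phi xi eta g ->
  generalized_km_space_form phi xi eta g D f1 f2 f3 f4 f5 f6 ->
  generalized_km_space phi xi eta g D (f1 - f3) (f4 - f6).
Proof.
move=> _ cm [_ Rf]; split=> // X Y; have [acm deta] := cm.
have [eta1 _ _] := acm.
have gxi := metric_xi acm; have etaphi := eta_phi acm.
have etah Z : eta (tensor_h phi xi Z) = 0 by apply: (eta_tensor_h acm).
have r1 : R1 g X Y xi = eta Y *: X - eta X *: Y by rewrite /R1 !gxi.
have r2 : R2 phi g X Y xi = 0.
  (* Every term of [R2] at [Z = xi] contains [phi xi]. *)
  by rewrite /R2 (phi_xi acm) !metric0r !scale0r scaler0 subr0 addr0.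
have r3 : R3 xi eta g X Y xi = - (eta Y *: X - eta X *: Y).
  by rewrite /R3 !gxi eta1 !mulr1 [eta Y * eta X]mulrC addrK opprB.
have r4 : R4 phi xi g X Y xi =
    eta Y *: tensor_h phi xi X - eta X *: tensor_h phi xi Y.
  by rewrite /R4 !gxi !etah !scale0r addr0 subr0.
have r5 : R5 phi xi g X Y xi = 0.
  (* All four coefficients become [eta] of a value of [h] or of [phi]. *)
  by rewrite /R5 !gxi !etah !etaphi !scale0r !subr0 addr0.
have r6 : R6 phi xi eta g X Y xi =
    - (eta Y *: tensor_h phi xi X - eta X *: tensor_h phi xi Y).
  by rewrite /R6 !gxi !etah eta1 !mulr1 !mul0r !scale0r addr0 subr0 opprB.
rewrite Rf r1 r2 r3 r4 r5 r6 !scaler0 !addr0 !scalerN.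
by rewrite !scalerBl -!addrA.
Qed.
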